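(* Let $X=(X,d,\mu)$ be a metric measure space with a doubling measure $\mu$. Let $1\le p\le q<\infty$, $\beta\in\mathbb{R}$ and let $\Omega\subsetneq X$ be an open set. The $(q,p,\beta)$-Hardy--Sobolev inequality holds in $\Omega$ if and only if there is a constant $C_1$ such that $$\int_E\frac{\mu(B(x,d(x,\Omega^c)))^{\frac{q-p}{p}}}{d(x,\Omega^c)^{\frac{q}{p}(p-\beta)}}\,d\mu(x)\le C_1\operatorname{cap}_{p,\beta}(E,\Omega)^{\frac{q}{p}}$$ for all $E\Subset\Omega$.
   Context: Standing assumptions: $X=(X,d,\mu)$ is a metric space with a Borel measure $\mu$ such that $0<\mu(B)<\infty$ for every open ball $B=B(x,r)$, and $\mu$ is doubling: there is a constant $C_\mu$ with $\mu(B(x,2r))\le C_\mu\,\mu(B(x,r))$ for all balls. Upper gradients: for $1\le p<\infty$, a $\mu$-measurable $g\colon X\to[0,\infty]$ is a $p$-weak upper gradient of $u\colon X\to[-\infty,\infty]$ if $|u(\gamma(0))-u(\gamma(\ell_\gamma))|\le\int_\gamma g\,ds$ for $p$-almost every (rectifiable, arc-length parametrized) curve $\gamma\colon[0,\ell_\gamma]\to X$; that is, there is a non-negative Borel function $\rho\in L^p_{\mathrm{loc}}(X;d\mu)$ such that $\int_\gamma\rho\,ds=\infty$ whenever the inequality fails or is not defined. For $u\in L^p(X;d\mu)$, $\mathcal{D}^p(u)$ is the set of all $p$-weak upper gradients $g\in L^p(X;d\mu)$ of $u$. Newtonian spaces: $N^{1,p}(X)$ is the set of functions $u\colon X\to[-\infty,\infty]$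 (defined everywhere) with $\|u\|_{N^{1,p}(X)}=\bigl(\int_X|u|^p\,d\mu+\inf_{g\in\mathcal{D}^p(u)}\int_X g^p\,d\mu\bigr)^{1/p}<\infty$. For open $\Omega\subset X$, $\Omega^c=X\setminus\Omega$, $d(x,\Omega^c)=\operatorname{dist}(x,\Omega^c)$, and $N^{1,p}_c(\Omega)$ is the set of $u\in N^{1,p}(X)$ whose support (the closure of $\{u\ne0\}$) is bounded and has strictly positive distance to $\Omega^c$. Hardy--Sobolev inequality: the $(q,p,\beta)$-Hardy--Sobolev inequality holds in $\Omega$ if there is a constant $C>0$ such that $$\biggl(\int_{\Omega}\frac{|u(x)|^q}{d(x,\Omega^c)^{\frac{q}{p}(p-\beta)}}\mu(B(x,d(x,\Omega^c)))^{\frac{q-p}{p}}\,d\mu(x)\biggr)^{\frac1q}\le C\biggl(\int_\Omega g(x)^p\,d(x,\Omega^c)^\beta\,d\mu(x)\biggr)^{\frac1p}$$ for all $u\in N^{1,p}_c(\Omega)$ and all $g\in\mathcal{D}^p(u)$. Capacity: $E\Subset\Omega$ means $E$ is bounded and $\operatorname{dist}(E,\Omega^c)>0$. For such $E$, $$\operatorname{cap}_{p,\beta}(E,\Omega)=\inf_u\inf_g\int_\Omega g(x)^p\,d(x,\Omega^c)^\beta\,d\mu(x),$$ the infimum taken over all $u\in N^{1,p}_c(\Omega)$ with $u(x)\ge1$ for all $x\in E$ and all $g\in\mathcal{D}^p(u)$. *)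

(* Defs.v *)
From HB Require Import structures.
From mathcomp Require Import all_boot all_order all_algebra.
From mathcomp Require Import all_classical all_reals all_analysis.
From mathcomp Require Import measurable_realfun.

Set Implicit Arguments.
Unset Strict Implicit.
Unset Printing Implicit Defensive.

Import Order.TTheory GRing.Theory Num.Theory.
Import numFieldNormedType.Exports.

Local Open Scope classical_set_scope.
Local Open Scope ring_scope.

(* The base point is only there because the measure theory of the library
   requires pointed carriers. *)
#[short(type="pmetricType")]
HB.structure Definition PointedMetric (K : numDomainType) :=
  {M of Metric K M & isPointed M}.

(* The real line with its Lebesgue measurable sets, on which
   completed_lebesgue_measure is defined. *)
Notation lebesgueType R := (caratheodory_type ((@wlength R idfun)^*)%mu).

Notation completion mu := (@completed_measure_extension _ _ _ mu).

Notation borelType X := (g_sigma_algebraType (@open X)).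

Section metric.
Context {R : realType} {X : pmetricType R}.
Implicit Types (x : X) (A B E Omega : set X).

(* Meaningful for A nonempty. *)
Definition dist_to x A : R := inf [set mdist x y | y in A].

(* Extended real valued, so that the empty set is at distance +oo from any
   set. *)
Definition set_dist A B : \bar R :=
  ereal_inf [set (mdist x y)%:E | x in A & y in B].

Definition bounded A := exists x r, A `<=` ball x r.

Definition well_inside E Omega := bounded E /\ (0 < set_dist E (~` Omega))%E.

Definition fun_support (u : X -> \bar R) : set X := closure [set x | u x != 0%E].

(* Length of a curve gam : [a, b] -> X, following numfun.variation. *)
Definition curve_variation (gam : R -> X) (a b : R) (s : seq R) : R :=
  let F := gam \o nth b (a :: s) in
  \sum_(0 <= n < size s) mdist (F n) (F n.+1).

Definition curve_length (gam : R -> X) (a b : R) : \bar R :=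
  ereal_sup [set (curve_variation gam a b s)%:E | s in itv_partition a b].

(* Nonconstant rectifiable curves [0, l] -> X parametrized by arc length; the
   values of gam outside [0, l] are irrelevant. *)
Definition arc_length_curve (gam : R -> X) (l : R) :=
  [/\ 0 < l, {within `[0, l], continuous gam} &
      forall s t, 0 <= s -> s <= t -> t <= l ->
        curve_length gam s t = (t - s)%:E].

(* Lebesgue (rather than Borel) measurability on the line, since the functions
   integrated along curves need not be Borel. *)
Definition curve_integrand_measurable (g : X -> \bar R) (gam : R -> X) (l : R) :=
  measurable_fun (`[0, l]%classic : set (lebesgueType R))
    (g \o gam : lebesgueType R -> \bar R).

Definition curve_integral (g : X -> \bar R) (gam : R -> X) (l : R) : \bar R :=
  (\int[completed_lebesgue_measure]_(t in `[0%R, l]) g (gam t))%E.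

(* The inequality is not defined when u (gam 0%R) - u (gam l) is of the form
   oo - oo, or when g is not measurable along gam. *)
Definition upper_gradient_ineq (u g : X -> \bar R) (gam : R -> X) (l : R) :=
  [/\ (u (gam 0%R) +? - u (gam l))%E,
      curve_integrand_measurable g gam l &
      (`|u (gam 0%R) - u (gam l)| <= curve_integral g gam l)%E].

End metric.

Section newtonian.
Context {R : realType} {X : pmetricType R}.
Variable mu : {measure set (borelType X) -> \bar R}.
Implicit Types (p q beta : R) (u g rho : X -> \bar R) (E Omega : set X).
Local Open Scope ereal_scope.

Definition positive_finite_on_balls := forall (x : X) (r : R), (0 < r)%R ->
  0 < mu (ball x r) /\ mu (ball x r) < +oo.

Definition doubling := exists Cmu : R, forall (x : X) (r : R), (0 < r)%R ->
  mu (ball x (2 * r)%R) <= Cmu%:E * mu (ball x r).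

(* mu-measurability refers to the completion of mu. When mu is sigma-finite (in
   particular when balls have finite measure), the sets that are Caratheodory
   measurable for the outer measure mu^* are exactly the elements of the
   completed Borel sigma-algebra. *)
Definition mu_measurable E := (mu^*)%mu.-cara.-measurable E.

Definition mu_measurable_fun g :=
  measurable_fun (setT : set (caratheodory_type (mu^*)%mu)) g.

Definition borel_fun g := measurable_fun (setT : set (borelType X)) g.

Local Notation muc := (completion mu).

Definition Lp p u :=
  mu_measurable_fun u /\ \int[muc]_x `|u x| `^ p < +oo.

Definition Lp_loc p u := mu_measurable_fun u /\
  forall x : X, exists2 r : R, (0 < r)%R &
    \int[muc]_(y in ball x r) `|u y| `^ p < +oo.

Definition weak_upper_gradient p u g :=
  [/\ mu_measurable_fun g, (forall x, 0 <= g x) &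
      exists rho, [/\ borel_fun rho, (forall x, 0 <= rho x), Lp_loc p rho &
        forall (gam : R -> X) (l : R), arc_length_curve gam l ->
          ~ upper_gradient_ineq u g gam l -> curve_integral rho gam l = +oo]].

Definition Dp p u : set (X -> \bar R) :=
  [set g | weak_upper_gradient p u g /\ Lp p g].

Definition N1p_norm p u : \bar R :=
  (\int[muc]_x `|u x| `^ p +
   ereal_inf [set \int[muc]_x g x `^ p | g in Dp p u]) `^ p^-1.

Definition N1p p : set (X -> \bar R) :=
  [set u | Lp p u /\ N1p_norm p u < +oo].

Definition N1p_c p Omega : set (X -> \bar R) :=
  [set u | N1p p u /\ well_inside (fun_support u) Omega].

Definition hardy_sobolev_weight q p beta Omega (x : X) : \bar R :=
  mu (ball x (dist_to x (~` Omega))) `^ ((q - p) / p) *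
  ((dist_to x (~` Omega) `^ (q / p * (p - beta)))^-1)%:E.

Definition weighted_energy p beta Omega g : \bar R :=
  \int[muc]_(x in Omega) (g x `^ p * (dist_to x (~` Omega) `^ beta)%:E).

Definition hardy_sobolev q p beta Omega :=
  exists2 C : R, (0 < C)%R &
    forall u g, N1p_c p Omega u -> Dp p u g ->
      (\int[muc]_(x in Omega)
         (`|u x| `^ q * hardy_sobolev_weight q p beta Omega x)) `^ q^-1
      <= C%:E * weighted_energy p beta Omega g `^ p^-1.

Definition cap p beta E Omega : \bar R :=
  ereal_inf [set ereal_inf [set weighted_energy p beta Omega g | g in Dp p u]
            | u in [set u | N1p_c p Omega u /\ forall x, E x -> 1 <= u x]].

End newtonian.

(* Main.v *)
Require Import Defs.
From HB Require Import structures.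
From mathcomp Require Import all_boot all_order all_algebra.
From mathcomp Require Import all_classical all_reals all_analysis.
From mathcomp Require Import measurable_realfun lra.

(* Maz'ya's truncation method: the level sets of [u] at the heights [2 ^ k] cut
   the left-hand side of the Hardy-Sobolev inequality into layers, and the part
   of [u] between two consecutive heights is a test function for the capacity of
   the next level set. Its energy only sees [g] on the layer below, so these
   energies add up to at most the energy of [g], and the capacity inequalities
   can be summed since [t `^ (q / p)] is superadditive.

   The point is that the restriction of [g] to a layer [{a < |u| < b}] is an
   upper gradient of the truncation of [u]. This needs no differentiation along
   curves: on a curve that, with all its subcurves, satisfies the upper gradient
   inequality, [|u|] is continuous, and the variation of the truncation is at
   most that of [|u|] between the last time at the lower height and the first
   later time at the upper one, which happens inside the layer. The exceptional
   curves are those along which the given exceptional density or a Borel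
   majorant of [g] has infinite integral. *)

Set Implicit Arguments.
Unset Strict Implicit.
Unset Printing Implicit Defensive.

Import Order.TTheory GRing.Theory Num.Theory.
Import numFieldNormedType.Exports.

Local Open Scope classical_set_scope.
Local Open Scope ring_scope.

(** * Integrals and Borel majorants *)

Section extended_power.
Context {R : realType}.
Local Open Scope ereal_scope.

Lemma le_poweR (r : R) (x y : \bar R) : (0 <= r)%R -> 0 <= x -> x <= y ->
  x `^ r <= y `^ r.
Proof.
move=> r0 x0 xy; apply: gt0_ler_poweR => //.
- by rewrite in_itv/= x0 leey.
- by rewrite in_itv/= leey (le_trans x0 xy).
Qed.

(** For finite values, t^r = t * t^(r - 1) and t^(r - 1) is nondecreasing, so both terms on the left
    are bounded through the common factor (x + y)^(r - 1). *)
Lemma poweR_superadditive (r : R) (x y : \bar R) : (1 <= r)%R ->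
  0 <= x -> 0 <= y ->
  x `^ r + y `^ r <= (x + y) `^ r.
Proof.
move=> r1; have r0 : (0 < r)%R by exact: lt_le_trans r1.
case: x => [x| |//]; case: y => [y| |//]; rewrite ?addye ?addey// => x0 y0;
  rewrite ?(poweRyr (lt0r_neq0 r0)) ?leey//.
rewrite -EFinD !poweR_EFin lee_fin; rewrite !lee_fin in x0 y0.
rewrite -(mulr_powRB1 x0 r0) -(mulr_powRB1 y0 r0) -(mulr_powRB1 (addr_ge0 x0
  y0) r0).
rewrite mulrDl lerD// ler_wpM2l// ge0_ler_powR ?subr_ge0// ?nnegrE ?addr_ge0//.
- by rewrite lerDl.
- by rewrite lerDr.
Qed.

Lemma sum_poweR_le (I : Type) (s : seq I) (r : R) (F : I -> \bar R) :
  (1 <= r)%R ->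
  (forall i, 0 <= F i) -> \sum_(i <- s) F i `^ r <= (\sum_(i <- s) F i) `^ r.
Proof.
move=> r1 F0; elim: s => [|i s ih]; first by rewrite !big_nil poweR_ge0.
rewrite !big_cons; apply: le_trans (poweR_superadditive r1 (F0 i) (sume_ge0 _
  _)) => //.
by rewrite leeD2l.
Qed.

End extended_power.

Section general_measure.
Local Open Scope ereal_scope.
Import HBNNSimple.
Context d (T : measurableType d) (R : realType).
Variable mu : {measure set T -> \bar R}.

(** The integral of a nonnegative function is the supremum over the simple functions below it, so it
    is monotone on arbitrary functions, in particular on compositions with curves. *)
Lemma ge0_le_integral_nonmeasurable (D : set T) (f g : T -> \bar R) :
  (forall x, D x -> 0 <= f x) -> (forall x, D x -> f x <= g x) ->
  \int[mu]_(x in D) f x <= \int[mu]_(x in D) g x.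
Proof.
move=> f0 fg; have g0 x : D x -> 0 <= g x.
  by move=> Dx; exact: le_trans (f0 _ Dx) (fg _ Dx).
rewrite !ge0_integralE//; apply: ge_ereal_sup => _ [h/= hf <-].
apply: ereal_sup_ubound; exists h => // x; apply: le_trans (hf x) _.
by apply: lee_restrict.
Qed.

Lemma ge0_subset_integral_nonmeasurable (D E : set T) (f : T -> \bar R) :
  (forall x, E x -> 0 <= f x) -> D `<=` E ->
  \int[mu]_(x in D) f x <= \int[mu]_(x in E) f x.
Proof.
move=> f0 DE; rewrite integral_mkcond [leRHS]integral_mkcond.
apply: ge0_le_integral_nonmeasurable => x _; last exact: restrict_lee.
by apply: erestrict_ge0 => y /DE; exact: f0.
Qed.

(** A simple function [h] below [f] gives [h \o phi] below [f \o phi] with the same integral. For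
    arbitrary [f] this yields one inequality; for an invertible [phi], such as a translation, the
    inverse map yields the other. *)
Lemma ge0_le_integral_measure_preserving (phi : T -> T) (f : T -> \bar R) :
  measurable_fun setT phi ->
  (forall A, measurable A -> mu (phi @^-1` A) = mu A) ->
  (forall x, 0 <= f x) ->
  \int[mu]_x f x <= \int[mu]_x f (phi x).
Proof.
move=> mphi muphi f0; rewrite ge0_integralTE//.
apply: ge_ereal_sup => _ [h/= hf <-].
rewrite -integralT_nnsfun.
pose nu : {measure set T -> \bar R} := pushforward mu phi.
rewrite (@eq_measure_integral _ _ _ setT (nu mphi)); last first.
  by move=> A mA _; rewrite /nu /= /pushforward muphi.
rewrite ge0_integral_pushforward//=; last 2 first.
- exact/measurable_EFinP.
- by move=> y _; rewrite lee_fin.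
rewrite preimage_setT; apply: ge0_le_integral_nonmeasurable => x _.
- by rewrite lee_fin.
- exact: hf.
Qed.

End general_measure.

(** * Translation invariance of the completed Lebesgue measure *)

Section translation.
Context {R : realType}.
Local Open Scope ereal_scope.
Implicit Types (A B : set R) (c : R).
Notation oleb := ((@wlength R idfun)^*)%mu.
Notation leb := (@completed_lebesgue_measure R).

(** Translating a countable cover by half-open intervals preserves the lengths. *)
Let le_oleb_translation c A : oleb ((fun x => (c + x)%R) @^-1` A) <= oleb A.
Proof.
apply: le_ereal_inf_tmp => _ [F [mF AF] <-].
apply: ereal_inf_lbound; exists (fun i => (fun x => (c + x)%R) @^-1` F i).
  split; last by move=> x /AF[i _ Fi]; exists i.
  move=> i; have [[a b] /= _ <-] := mF i; exists ((a - c)%R, (b - c)%R) => //.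
  by apply/seteqP; split => x /=; rewrite !in_itv/= ltrBlDl lerBrDl.
apply: eq_eseriesr => i _; have [[a b] /= _ <-] := mF i.
have -> : (fun x => (c + x)%R) @^-1` `]a, b] = `](a - c)%R, (b - c)%R]%classic.
  by apply/seteqP; split => x /=; rewrite !in_itv/= ltrBlDl lerBrDl.
rewrite !wlength_itv /= !lte_fin ltrBlDr subrK.
by case: ifP => // _; rewrite -!EFinB opprB addrA subrK.
Qed.

Let oleb_translation c A : oleb ((fun x => (c + x)%R) @^-1` A) = oleb A.
Proof.
apply/eqP; rewrite eq_le le_oleb_translation/=.
have := le_oleb_translation (- c)%R ((fun x => (c + x)%R) @^-1` A).
rewrite -comp_preimage (_ : _ \o _ = id) ?preimage_id//.
by apply/funext => x /=; rewrite addNKr.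
Qed.

Lemma measurable_translation c :
  measurable_fun setT ((fun x => (c + x)%R) : lebesgueType R -> lebesgueType R).
Proof.
move=> _ B mB; rewrite setTI.
suff : caratheodory_measurable oleb ((fun x => (c + x)%R) @^-1` B) by [].
have {}mB : caratheodory_measurable oleb B := mB.
(* Every test set is the preimage of one of its translates, so Caratheodory's criterion for [B]
   carries over by invariance of the outer measure. *)
move=> X; have [X' ->] : exists X', X = (fun x => (c + x)%R) @^-1` X'.
  exists ((fun x => (- c + x)%R) @^-1` X); rewrite -comp_preimage.
  by rewrite (_ : _ \o _ = id) ?preimage_id//; apply/funext => x /=;
    rewrite addKr.
have := mB X'; rewrite -(oleb_translation c X') -(oleb_translation c (X' `&`
  B)).
by rewrite -(oleb_translation c (X' `&` ~` B)).
Qed.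

Lemma completed_lebesgue_measure_translation c (B : set (lebesgueType R)) :
  leb ((fun x => (c + x)%R) @^-1` B) = leb B.
Proof. exact: oleb_translation. Qed.

Lemma ge0_integral_translation c (f : R -> \bar R) :
  (forall x, 0 <= f x) -> \int[leb]_x f (c + x)%R = \int[leb]_x f x.
Proof.
move=> f0.
have key k (h : R -> \bar R) : (forall x, 0 <= h x) ->
    \int[leb]_x h x <= \int[leb]_x h (k + x)%R.
  exact: (@ge0_le_integral_measure_preserving _ (lebesgueType R) _ leb
    (fun x => (k + x)%R) h (measurable_translation _)
    (fun A _ => completed_lebesgue_measure_translation _ _)).
apply/eqP; rewrite eq_le key// andbT.
apply: le_trans (key (- c)%R (fun x => f (c + x)%R) _) _ => //.
by rewrite (_ : (fun x => f (c + (- c + x))%R) = f)//; apply/funext => x;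
  rewrite addNKr.
Qed.

Lemma ge0_integral_itv_translation c (a b : R) (f : R -> \bar R) :
  (forall x, 0 <= f x) ->
  \int[leb]_(x in `[a, b]) f (c + x)%R =
  \int[leb]_(x in `[(c + a)%R, (c + b)%R]) f x.
Proof.
move=> f0; rewrite integral_mkcond [RHS]integral_mkcond.
rewrite -[RHS](ge0_integral_translation c).
  apply: eq_integral => x _; rewrite /patch.
  have -> // : (x \in `[a, b]%classic) =
      ((c + x)%R \in `[(c + a)%R, (c + b)%R]%classic).
  by apply/idP/idP => /set_mem/=; rewrite in_itv/= => xab; apply/mem_set;
    move: xab; rewrite /= in_itv/= !lerD2l.
by apply: erestrict_ge0 => x _.
Qed.
End translation.

Section borel_majorant.
Local Open Scope ereal_scope.
Context d (T : measurableType d) (R : realType).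
Variable mu : {measure set T -> \bar R}.
Notation oms := (mu^*)%mu.
Hypothesis sfmu : @sigma_finite _ T _ setT mu.

(** [B] is an intersection of measurable covers of [A] whose outer measures exceed that of [A] by at
    most 1 / (n + 1). *)
Let finite_majorant (A : set T) : caratheodory_measurable oms A ->
  oms A < +oo ->
  exists2 B, measurable B & A `<=` B /\ oms (B `\` A) = 0.
Proof.
move=> mA Aoo.
have Afin : oms A \is a fin_num by rewrite ge0_fin_numE ?outer_measure_ge0.
have cover n : exists G,
    [/\ measurable G, A `<=` G & oms G <= oms A + n.+1%:R^-1%:E].
  have n0 : (0 < n.+1%:R^-1 :> R)%R by rewrite invr_gt0.
  move: (Afin) => /lb_ereal_inf_adherent =>
    /(_ _ n0) [_/= [F [mF AF] <-] /ltW Fn].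
  exists (\bigcup_k F k); split => //; first exact: bigcupT_measurable.
  apply: le_trans Fn; apply: le_trans (outer_measure_sigma_subadditive _ _) _.
  by apply: lee_nneseries => // k _; rewrite -(measurable_mu_extE mu (mF k)).
have [G GP] := choice cover.
pose B := \bigcap_n G n.
have AB : A `<=` B by move=> x Ax n _; have [_ + _] := GP n; exact.
exists B; first by apply: bigcapT_measurable => n; have [] := GP n.
split=> //.
have BA : oms B <= oms A.
  apply/lee_addgt0Pr => _/posnumP[e]; near \oo => n.
  have [_ _ Gn] := GP n; apply: (@le_trans _ _ (oms (G n))).
    by apply: le_outer_measure; exact: bigcap_inf.
  apply: le_trans Gn _; rewrite leeD2l// lee_fin ltW//.
  by near: n; exact: near_infty_natSinv_lt.
(* Caratheodory's criterion for [A], tested on [B], splits the outer measure of [B] into those of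
   [A] and of the difference. The first part is finite and already at least the total, so the second
   vanishes. *)
have := mA B; rewrite setIidr// -setDE => E.
apply/eqP; rewrite eq_le outer_measure_ge0 andbT.
by rewrite -(@leeD2lE _ (oms A))// adde0 -E.
Unshelve. all: by end_near. Qed.

Lemma caratheodory_measurable_majorant (A : set T) :
  caratheodory_measurable oms A ->
  exists2 B, measurable B & A `<=` B /\ oms (B `\` A) = 0.
Proof.
move=> mA; have [S ST Sfin] := sfmu.
have mS n : caratheodory_measurable oms (S n).
  have [mSn _] := Sfin n.
  exact: (@caratheodory_measurable_mu_ext _ _ T mu _ mSn).
have SA n : exists B,
    measurable B /\ (A `&` S n `<=` B /\ oms (B `\` (A `&` S n)) = 0).
  have [|| B] := @finite_majorant (A `&` S n); last by exists B.
    exact: caratheodory_measurable_setI.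
  apply: le_lt_trans (_ : oms (S n) < +oo); first exact: le_outer_measure.
  by have [mSn] := Sfin n; rewrite measurable_mu_extE.
have [B BP] := choice SA.
exists (\bigcup_n B n); first by apply: bigcupT_measurable => n;
  have [] := BP n.
split.
  move=> x Ax; have [n _ Sx] : (\bigcup_n S n) x by rewrite -ST.
  by exists n => //; have [_ [+ _]] := BP n; apply.
apply/eqP; rewrite eq_le outer_measure_ge0 andbT.
apply: (@le_trans _ _ (oms (\bigcup_n (B n `\` (A `&` S n))))).
  apply: le_outer_measure => x [[n _ Bx] nAx]; exists n => //; split => //.
  by move=> [].
apply: le_trans (outer_measure_sigma_subadditive _ _) _.
by rewrite eseries0// => n _ _; have [_ []] := BP n.
Qed.

(** Each set {r < g} with [r] rational has a Borel majorant, and [h x] is the supremum of max(0, r)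
    over the [r] whose majorant contains [x]. Every rational below [g x] takes part, so [g <= h];
    equality can fail only where some majorant exceeds its set, which is a countable union of null
    sets. *)
Lemma measurable_fun_majorant (g : caratheodory_type oms -> \bar R) :
  measurable_fun setT g -> (forall x, 0 <= g x) ->
  exists h : T -> \bar R, [/\ measurable_fun setT h, (forall x, g x <= h x) &
    exists N, [/\ caratheodory_measurable oms N, oms N = 0 &
      forall x, ~ N x -> h x = g x]].
Proof.
move=> mg g0; pose q n : R := ratr (odflt 0%R (unpickle n)).
have mA n : caratheodory_measurable oms [set x | (q n)%:E < g x].
  by have := emeasurable_fun_o_infty measurableT mg (q n)%:E; rewrite setTI.
have [B BP] := choice (fun n => let: ex_intro2 B x y :=
  caratheodory_measurable_majorant (mA n) in
  ex_intro _ B (conj x y)).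
pose u x n := if x \in B n then maxe 0 (q n)%:E else 0.
pose h x := esups (u x) 0%N.
have ule x n : u x n <= h x by apply: ereal_sup_ubound; exists n.
have gh x : g x <= h x.
  rewrite leNgt; apply/negP => hg.
  have h0 : 0 <= h x.
    by apply: le_trans (ule x 0%N); rewrite /u; case: ifP => //;
      rewrite le_max lexx.
  have [r hr rg] : exists2 r : rat, h x < (ratr r)%:E & (ratr r)%:E < g x.
    case: (g x) (g0 x) hg => [y| |//] _; case: (h x) h0 => [z| |//] _ //.
    - by rewrite lte_fin => /rat_in_itvoo[r]; rewrite in_itv/= => /andP[? ?];
        exists r.
    - have /rat_in_itvoo[r] : (z < z + 1)%R by rewrite ltrDl.
      by rewrite in_itv/= => /andP[? ?] _; exists r; rewrite ?lte_fin ?ltry.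
  have := ule x (pickle r); rewrite /u /q pickleK/=.
  have [_ [/(_ x) + _]] := BP (pickle r).
  rewrite /= /q pickleK /= => /(_ rg) => Bx; rewrite mem_set// leNgt => /negP;
    apply.
  by rewrite lt_max hr orbT.
exists h; split => //.
- apply: measurable_fun_esups => n.
  apply: measurable_fun_if => //.
    by apply: (measurable_fun_bool true); rewrite setTI preimage_mem_true;
      have [] := BP n.
- exists (\bigcup_n (B n `\` [set x | (q n)%:E < g x])); split.
  + apply: (@bigcupT_measurable _ (caratheodory_type oms)) => n.
    apply: measurableD; last exact: mA.
    by have [mB _] := BP n; exact: (@caratheodory_measurable_mu_ext _ _ T mu _
      mB).
  + apply/eqP; rewrite eq_le outer_measure_ge0 andbT.
    apply: le_trans (outer_measure_sigma_subadditive _ _) _.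
    by rewrite eseries0// => n _ _; have [_ []] := BP n.
  move=> x Nx; apply/eqP; rewrite eq_le gh andbT.
  apply: ge_ereal_sup => _ [n _ <-]; rewrite /u; case: ifP => // /set_mem Bx.
  rewrite ge_max g0/= ltW//; apply: contrapT => gx; apply: Nx; exists n => //.
Qed.
End borel_majorant.

Section absolute_continuity.
Local Open Scope ereal_scope.
Context d (T : measurableType d) (R : realType).
Variable mu : {measure set T -> \bar R}.

(** A function with finite integral is finite almost everywhere, so the statement reduces to the
    absolute continuity of the integral of a real-valued function, here the finite part [f] of
    [h]. *)
Lemma ge0_integral_absolutely_continuous (D : set T) (h : T -> \bar R) (e : R) :
  measurable D -> measurable_fun D h -> (forall x, D x -> 0 <= h x) ->
  \int[mu]_(x in D) h x < +oo -> (0 < e)%R ->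
  exists2 r : R, (0 < r)%R & forall A, measurable A -> A `<=` D ->
    mu A < r%:E -> \int[mu]_(x in A) h x < e%:E.
Proof.
move=> mD mh h0 hoo e0.
have hDi : mu.-integrable D h.
  apply/integrableP; split => //.
  by under eq_integral => x /set_mem Dx do rewrite gee0_abs ?h0//.
have hi : mu.-integrable setT (h \_ D) by apply/integrable_restrict => //;
  rewrite setTI.
have h'0 x : 0 <= (h \_ D) x by apply: erestrict_ge0.
pose f x := fine ((h \_ D) x).
have f0 x : (0 <= f x)%R by exact: fine_ge0.
have mf : measurable_fun setT (EFin \o f).
  apply/measurable_EFinP; apply: measurableT_comp; first exact: fine_measurable.
  exact: measurable_int hi.
have fh x : (f x)%:E <= (h \_ D) x.
  by rewrite /f; case: ((h \_ D) x) (h'0 x) => //=; rewrite leey.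
have fi : mu.-integrable setT (EFin \o f).
  apply: le_integrable hi => // x _ /=.
  by rewrite ger0_norm// (gee0_abs (h'0 x)).
have [r [r0 rP]] := integral_normr_continuous fi e0.
exists r => // A mA AD /(rP _ mA).
have fAi : mu.-integrable A (EFin \o f) by exact: integrableS fi.
rewrite -lte_fin /Rintegral.
under eq_integral do rewrite ger0_norm//.
rewrite fineK; last exact: integrable_fin_num.
congr (_ < _); apply: ae_eq_integral => //.
- by apply: measurable_funS mf.
- exact: measurable_funS mh.
have := integrable_ae mD hDi; apply: filterS => x hx Ax.
by rewrite /f patchE mem_set ?fineK//; [exact/hx/AD|exact: AD].
Qed.
End absolute_continuity.

(** * Truncation along a curve *)

Section crossing.
Context {R : realType}.
Implicit Types (phi : R -> R) (a b l : R).

Lemma compact_sublevel phi a b (c : R) : {within `[a, b], continuous phi} ->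
  compact (`[a, b] `&` [set x | phi x <= c]).
Proof.
move=> cphi.
have /closed_subspaceP[V cV VE] :
    closed (phi @^-1` [set x | x <= c] : set (subspace `[a, b])).
  by apply: preimage_closed => //; exact: closed_le.
rewrite setIC -[_ `&` _]VE setIC; apply: compact_closedI => //.
exact: segment_compact.
Qed.

(* [s] is the last time where [phi <= al], and [t] the first later time where
   [be <= phi]. *)
Lemma last_first_crossing phi a b (al be : R) :
  {within `[a, b], continuous phi} -> a <= b ->
  phi a <= al -> al < be -> be <= phi b ->
  exists s t, [/\ a <= s, s < t, t <= b, be - al <= phi t - phi s &
    forall x, s < x < t -> al < phi x < be].
Proof.
move=> cphi ab phia albe phib.
have cid A : {within A, continuous (id : R -> R)}.
  by apply: continuous_subspaceT => x; exact: cvg_id.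
have S0 : `[a, b] `&` [set x | phi x <= al] !=set0.
  by exists a; split => //=; rewrite in_itv/= lexx.
have [s /set_mem[/=]] := compact_EVT_max S0 (compact_sublevel cphi) (cid _).
rewrite in_itv/= => /andP[as_ sb] phis smax.
have cNphi : {within `[s, b], continuous (- phi)}.
  apply: (@continuous_subspaceW _ _ _ `[a, b]).
    by apply: subset_itvr; rewrite bnd_simp.
  by move=> x; apply: cvgN; exact: cphi.
have cNid A : {within A, continuous (-%R : R -> R)}.
  by apply: continuous_subspaceT => x; exact: opp_continuous.
have T0 : `[s, b] `&` [set x | (- phi) x <= - be] !=set0.
  by exists b; split => /=; rewrite ?in_itv/= ?lexx ?andbT// lerN2.
have [t /set_mem[/=]] := compact_EVT_max T0 (compact_sublevel cNphi) (cNid _).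
rewrite in_itv/= => /andP[st tb]; rewrite lerN2 => phit tmin.
exists s, t; split => //.
- by rewrite lt_neqAle st andbT; apply/eqP => E; move: phis;
    rewrite E leNgt (lt_le_trans albe).
- by rewrite lerB.
move=> x /andP[sx xt]; rewrite !ltNge; apply/andP; split; apply/negP => phix.
  have := smax x; rewrite leNgt sx => /(_ _)/notF; apply; apply/mem_set;
    split => //=.
  by rewrite in_itv/= (le_trans as_ (ltW sx)) (le_trans (ltW xt)).
have := tmin x; rewrite lerN2 leNgt xt => /(_ _)/notF; apply; apply/mem_set;
  split => /=.
  by rewrite in_itv/= (ltW sx) (le_trans (ltW xt)).
by rewrite lerN2.
Qed.
End crossing.

(** * Subcurves of arc-length parametrized curves *)

Section subcurves.
Context {R : realType} {X : pmetricType R}.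
Implicit Types (gam : R -> X) (u g rho : X -> \bar R).

Let curve_length_translation_le gam (c a b : R) :
  (curve_length (fun x => gam (c + x)%R) a b <=
   curve_length gam (c + a)%R (c + b)%R)%E.
Proof.
apply: ge_ereal_sup => _ [s sab <-].
apply: ereal_sup_ubound; exists (map (+%R c) s).
  case: sab => psab /eqP lsab; split; last by rewrite last_map lsab.
  by rewrite path_map; apply: sub_path psab => x y /=; rewrite ltrD2l.
rewrite /curve_variation size_map; congr (_%:E).
have nthE n : nth (c + b) (c + a :: map (+%R c) s) n = c + nth b (a :: s) n.
  rewrite -(map_cons (+%R c)).
  have [ns|ns] := ltnP n (size (a :: s)); first by rewrite (nth_map b).
  by rewrite !nth_default// size_map.
by apply: eq_bigr => n _; rewrite /comp !nthE.
Qed.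

Lemma curve_length_translation gam (c a b : R) :
  curve_length (fun x => gam (c + x)) a b = curve_length gam (c + a) (c + b).
Proof.
apply/eqP; rewrite eq_le curve_length_translation_le/=.
have := curve_length_translation_le (fun x =>
  gam (c + x)) (- c) (c + a) (c + b).
rewrite !addKr; apply: le_trans.
by rewrite (_ : (fun x => gam (c + (- c + x))) = gam)//; apply/funext => x;
  rewrite addNKr.
Qed.

Lemma arc_length_subcurve gam (l s t : R) : arc_length_curve gam l ->
  0 <= s -> s < t -> t <= l -> arc_length_curve (fun x => gam (s + x)) (t - s).
Proof.
move=> [l0 cgam lgam] s0 st tl; split; first by rewrite subr_gt0.
- apply/subspace_continuousP => x /=; rewrite in_itv/= => /andP[x0 xts].
  have /subspace_continuousP/(_ (s + x)) := cgam.
  have sxl : s + x <= l by apply: le_trans tl; rewrite -lerBrDl.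
  have {}sxl : `[0, l]%classic (s + x) by rewrite /= in_itv/= addr_ge0.
  move=> /(_ sxl) cgamx; apply: cvg_comp cgamx => B /= nB.
  have cs : {for x, continuous (fun y : R => s + y)}.
    by apply: continuousD; [exact: cvg_cst|exact: cvg_id].
  move: (cs _ nB); rewrite /within/= !nbhs_simpl/=; apply: filterS => y /= yB.
  rewrite in_itv/= => /andP[y0 yts]; apply: yB.
  by rewrite in_itv/= addr_ge0//= (le_trans _ tl)// -lerBrDl.
- move=> s' t' s'0 s't' t't; rewrite curve_length_translation lgam.
  + by rewrite opprD addrACA subrr add0r.
  + exact: addr_ge0.
  + by rewrite lerD2l.
  + by apply: le_trans tl; rewrite -lerBrDl.
Qed.

Lemma curve_integral_subcurve g gam (l s t : R) : (forall x, 0 <= g x)%E ->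
  0 <= s -> s < t -> t <= l ->
  curve_integral g (fun x => gam (s + x)) (t - s) =
    (\int[completed_lebesgue_measure]_(x in `[s, t]) g (gam x))%E.
Proof.
move=> g0 s0 st tl; rewrite /curve_integral.
rewrite (@ge0_integral_itv_translation _ s 0 (t - s) (g \o gam));
  last by move=> x /=.
by rewrite addr0 addrC subrK.
Qed.

Section good_curve.
Variables (u g rho : X -> \bar R) (gam : R -> X) (l : R).
Hypothesis rho0 : forall x, (0 <= rho x)%E.
Hypothesis g0 : forall x, (0 <= g x)%E.
Hypothesis arcgam : arc_length_curve gam l.
Hypothesis exceptional : forall gam' l', arc_length_curve gam' l' ->
  ~ upper_gradient_ineq u g gam' l' -> curve_integral rho gam' l' = +oo%E.
Hypothesis rhofin : (curve_integral rho gam l < +oo)%E.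
Notation leb := (@completed_lebesgue_measure R).

(** A subcurve violating the inequality would carry an infinite integral of [rho], and then so would
    [gam], contrary to [rhofin]. *)
Lemma upper_gradient_ineq_subcurve s t : 0 <= s -> s < t -> t <= l ->
  (u (gam s) +? - u (gam t) /\
  `|u (gam s) - u (gam t)| <= \int[leb]_(x in `[s, t]) g (gam x))%E.
Proof.
move=> s0 st tl.
have : upper_gradient_ineq u g (fun x => gam (s + x)) (t - s).
  apply: contrapT => /(exceptional (arc_length_subcurve arcgam s0 st tl)).
  rewrite (curve_integral_subcurve _ _ s0 st tl)//; apply/eqP; rewrite lt_eqF//.
  apply: le_lt_trans rhofin; rewrite /curve_integral.
  apply: ge0_subset_integral_nonmeasurable => //.
  by apply: subset_itv; rewrite bnd_simp.
move=> [+ _ +]; rewrite (curve_integral_subcurve _ _ s0 st tl)// addr0.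
by rewrite addrC subrK.
Qed.

End good_curve.
End subcurves.

Section truncation.
Context {R : realType}.
Local Open Scope ereal_scope.

(** Clipping precedes [fine], so that for [a <= b] an infinite [y] is sent to [b] and not to the
    default value 0 of [fine]. *)
Definition clip (a b : R) (y : \bar R) : R := fine (maxe a%:E (mine b%:E `|y|)).

(** For [a < b], rescaled to run from 0 where |u| <= a up to 1 where |u| >= b, as a test function
    for the capacity of the latter set. *)
Definition trunc {T : Type} (a b : R) (u : T -> \bar R) (x : T) : \bar R :=
  ((clip a b (u x) - a) / (b - a))%:E.

Definition trunc_gradient {T : Type} (a b : R) (u g : T -> \bar R) (x : T)
    : \bar R :=
  if (a%:E < `|u x|) && (`|u x| < b%:E) then (b - a)^-1%:E * g x else 0.

Lemma clip_fin (a b : R) (y : \bar R) : y \is a fin_num ->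
  clip a b y = Num.max a (Num.min b (fine `|y|)).
Proof. by case: y => //= y _; rewrite /clip/= -EFin_min -EFin_max. Qed.

(** Supplies the two heights for [last_first_crossing]: if the clamped value strictly increases from
    [y] to [z], then [y] was not cut down to [b] and [z] was not raised to [a]. *)
Lemma clamp_lt (a b y z : R) : (a < b)%R ->
  (Num.max a (Num.min b y) < Num.max a (Num.min b z))%R ->
  [/\ y <= Num.max a (Num.min b y), Num.max a (Num.min b z) <= z,
      a <= Num.max a (Num.min b y) & Num.max a (Num.min b z) <= b]%R.
Proof.
move=> ab; rewrite /Num.max /Num.min.
case: (ltP b y) => by_; case: (ltP b z) => bz; rewrite ?ab ?ltxx//.
all: by case: (ltP a y) => ay; case: (ltP a z) => az; rewrite ?ltxx// => H;
  split; lra.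
Qed.

End truncation.

Section truncation_line.
Context {R : realType}.
Local Open Scope ereal_scope.
Notation leb := (@completed_lebesgue_measure R).
Notation L := (lebesgueType R).

Lemma measurable_lebesgueType_itv (i : interval R) :
  measurable ([set` i] : set L).
Proof.
have : measurable ([set` i] : set (measurableTypeR R)) by exact: measurable_itv.
exact: sub_caratheodory.
Qed.

Lemma completed_lebesgue_measure_itvcc (s t : R) : (s <= t)%R ->
  leb `[s, t]%classic = (t - s)%:E.
Proof.
move=> st; transitivity (lebesgue_measure `[s, t]%classic) => //.
rewrite lebesgue_measure_itv /= lte_fin; case: ltP => // ts.
by have -> : t = s by [apply/eqP; rewrite eq_le st ts]; rewrite subrr.
Qed.

Lemma measurable_fun_lebesgueType (D : set R) (f : R -> R) :
  measurable_fun (D : set (measurableTypeR R)) f ->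
  measurable (D : set (measurableTypeR R)) ->
  measurable_fun (D : set L) f.
Proof.
move=> mf mD _ B mB; apply: sub_caratheodory.
exact: (mf mD B mB).
Qed.

(** [f] and [h] stand for [u] and [g] along a curve on [0, l], and [fh] is the inequality on all its
    subcurves. *)
Variables (l : R) (f h : R -> \bar R).
Hypothesis l0 : (0 < l)%R.
Hypothesis h0 : forall x, 0 <= h x.
Hypothesis mh : measurable_fun (`[0%R, l]%classic : set L) h.
Hypothesis hfin : \int[leb]_(x in `[0%R, l]) h x < +oo.
Hypothesis fh : forall s t, (0 <= s)%R -> (s < t)%R -> (t <= l)%R ->
  f s +? - f t /\ `|f s - f t| <= \int[leb]_(x in `[s, t]) h x.

Let subitv s t : (0 <= s)%R -> (t <= l)%R -> `[s, t] `<=` `[0%R, l]%classic.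
Proof. by move=> s0 tl; apply: subset_itv; rewrite bnd_simp. Qed.

Let hfinst s t : (0 <= s)%R -> (t <= l)%R -> \int[leb]_(x in `[s, t]) h x < +oo.
Proof.
move=> s0 tl; apply: le_lt_trans hfin.
by apply: ge0_subset_integral_nonmeasurable => //; exact: subitv.
Qed.

(** Every point of [0, l] is an end of a nondegenerate subinterval. An infinite value there would
    make the difference of the end values undefined or infinite, while the integral of [h] is
    finite. *)
Let ffin s : `[0%R, l]%classic s -> f s \is a fin_num.
Proof.
have key s' t' : (0 <= s')%R -> (s' < t')%R -> (t' <= l)%R ->
    f s' \is a fin_num /\ f t' \is a fin_num.
  move=> s0 st tl; have [] := fh s0 st tl => + H.
  have := le_lt_trans H (hfinst s0 tl).
  by case: (f s') => [?| |]; case: (f t') => [?| |].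
rewrite /= in_itv/= => /andP[s0 sl]; have [sl'|ls] := ltP s l.
  by have [] := key s l s0 sl' (lexx _).
have -> : s = l by apply/eqP; rewrite eq_le sl ls.
by have [] := key 0%R l (lexx _) l0 (lexx _).
Qed.

Let phi x := fine `|f x|.

Let phi_dist s t : (0 <= s)%R -> (s < t)%R -> (t <= l)%R ->
  (`|phi s - phi t|)%:E <= \int[leb]_(x in `[s, t]) h x.
Proof.
move=> s0 st tl; have [_] := fh s0 st tl; apply: le_trans; rewrite /phi.
have /fineK <- : f s \is a fin_num.
  by apply: ffin; rewrite /= in_itv/= s0 (le_trans (ltW st)).
have /fineK <- : f t \is a fin_num.
  by apply: ffin; rewrite /= in_itv/= tl (le_trans s0 (ltW st)).
by rewrite -EFinB !abse_EFin/= lee_fin ler_dist_dist.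
Qed.

(** The increments of [phi] are bounded by integrals of [h], which are small over short intervals by
    absolute continuity. *)
Let phi_continuous : {within `[0%R, l], continuous phi}.
Proof.
apply/subspace_continuousP => x /=; rewrite in_itv/= => /andP[x0 xl].
apply/cvgrPdist_lt => e e0.
have [r r0 rP] := ge0_integral_absolutely_continuous
  (measurable_lebesgueType_itv _) mh (fun x _ => h0 x) hfin e0.
have key s t : (0 <= s)%R -> (s < t)%R -> (t <= l)%R -> (t - s < r)%R ->
    (`|phi s - phi t| < e)%R.
  move=> s0 st tl tsr; rewrite -lte_fin;
    apply: le_lt_trans (phi_dist s0 st tl) _.
  apply: rP; [exact: measurable_lebesgueType_itv|exact: subitv|].
  by rewrite [ltLHS](completed_lebesgue_measure_itvcc (ltW st)) lte_fin.
near=> y.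
have : `[0%R, l]%classic y by near: y; exact: withinT.
rewrite /= in_itv/= => /andP[y0 yl].
have xyr : (`|x - y| < r)%R by near: y; apply: cvg_within; exact: nbhsx_ballx.
have [xy|yx|->] := ltgtP x y; last by rewrite subrr normr0.
- by apply: key => //; rewrite (le_lt_trans _ xyr)// distrC ler_norm.
- by rewrite distrC; apply: key => //; rewrite (le_lt_trans _ xyr)// ler_norm.
Unshelve. all: by end_near. Qed.

Let clip_phi a b t : `[0%R, l]%classic t ->
  clip a b (f t) = Num.max a (Num.min b (phi t)).
Proof. by move=> /ffin; exact: clip_fin. Qed.

Let clip_crossing a b : (a < b)%R -> clip a b (f 0%R) != clip a b (f l) ->
  exists s t, [/\ (0 <= s)%R, (s < t)%R, (t <= l)%R,
    (`|clip a b (f 0%R) - clip a b (f l)| <= `|phi s - phi t|)%R &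
    forall x, (s < x < t)%R -> (a < phi x < b)%R].
Proof.
move=> ab; have I0 : `[0%R, l]%classic 0%R by rewrite /= in_itv/= lexx ltW.
have Il : `[0%R, l]%classic l by rewrite /= in_itv/= lexx ltW.
rewrite (clip_phi a b I0) (clip_phi a b Il) neq_lt => /orP[] c01.
- have [y0 c1y ac cb] := clamp_lt ab c01.
  have [s [t [s0 st tl H K]]] := last_first_crossing phi_continuous (ltW l0) y0
    c01 c1y.
  exists s, t; split => //.
    by rewrite distrC [leRHS]distrC !ger0_norm; lra.
  by move=> x /K; lra.
- have [y0 c1y ac cb] := clamp_lt ab c01.
  (* When the clipped value decreases, the crossing lemma is applied to the opposite function, with
     the opposite heights. *)
  have cN : {within `[0%R, l], continuous (fun x => - phi x)%R}.
    by move=> x; apply: cvgN; exact: phi_continuous.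
  have c01N := c01; rewrite -ltrN2 in c01N.
  have [||s [t [s0 st tl H K]]] := last_first_crossing cN (ltW l0) _ c01N.
  + by rewrite lerN2.
  + by rewrite lerN2.
  have {}H : (Num.max a (Num.min b (phi 0%R)) - Num.max a (Num.min b (phi l))
    <= phi s - phi t)%R.
    by move: H => /=; lra.
  exists s, t; split => //.
    by rewrite !ger0_norm; lra.
  by move=> x /K; rewrite !ltrN2; lra.
Qed.

Let trunc_gradientE a b t : `[0%R, l]%classic t -> trunc_gradient a b f h t =
  if (a < phi t)%R && (phi t < b)%R then (b - a)^-1%:E * h t else 0.
Proof.
move=> /ffin; rewrite /trunc_gradient /phi.
by case: (f t) => //= r _; rewrite !lte_fin.
Qed.

(** Measurability along the curve is one of the clauses of [upper_gradient_ineq]. Here it follows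
    from the continuity of [phi], which makes the set of times spent in the layer measurable. *)
Lemma measurable_trunc_gradient_line a b :
  measurable_fun (`[0%R, l]%classic : set L) (trunc_gradient a b f h).
Proof.
have mphi : measurable_fun (`[0%R, l]%classic : set L) phi.
  have mI : measurable (`[0%R, l]%classic : set (measurableTypeR R)).
    exact: measurable_itv.
  apply: (fun mf => measurable_fun_lebesgueType mf mI).
  exact: subspace_continuous_measurable_fun mI phi_continuous.
apply: (eq_measurable_fun
  (fun t : L => if (a < phi t)%R && (phi t < b)%R then (b - a)^-1%:E * h t else
    0)).
  by move=> t /set_mem It; rewrite trunc_gradientE.
apply: measurable_fun_if; first exact: measurable_lebesgueType_itv.
- by apply: measurable_and; apply: measurable_fun_ltr.
- apply: measurable_funeM; apply: measurable_funS mh; last exact: subIsetl.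
  exact: measurable_lebesgueType_itv.
- exact: measurable_cst.
Qed.

Lemma trunc_le_integral_trunc_gradient a b : (a < b)%R ->
  `|trunc a b f 0%R - trunc a b f l| <=
    \int[leb]_(x in `[0%R, l]) trunc_gradient a b f h x.
Proof.
move=> ab; have ba0 : (0 < (b - a)^-1)%R by rewrite invr_gt0 subr_gt0.
have tg0 x : 0 <= trunc_gradient a b f h x.
  by rewrite /trunc_gradient; case: ifP => // _; rewrite mule_ge0// lee_fin ltW.
rewrite /trunc -EFinB abse_EFin -mulrBl opprB addrA subrK normrM (gtr0_norm
  ba0).
have [->|c01] := eqVneq (clip a b (f 0%R)) (clip a b (f l)).
  by rewrite subrr normr0 mul0r; apply: integral_ge0.
have [s [t [s0 st tl c01phi phiab]]] := clip_crossing ab c01.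
have mst := measurable_lebesgueType_itv `[s, t].
have mhst : measurable_fun (`[s, t]%classic : set L) h.
  by apply: measurable_funS mh; [exact: measurable_lebesgueType_itv|exact:
    subitv].
(* The crossing places [phi] strictly between [a] and [b] only at times strictly between [s] and
   [t], so the two end times are discarded as a null set. *)
pose N : set L := [set s] `|` [set t].
have m1 x : measurable ([set x] : set L) /\ leb [set x] = 0.
  rewrite -set_itv1; split; first exact: measurable_lebesgueType_itv.
  by rewrite completed_lebesgue_measure_itvcc// subrr.
have mN : measurable N by apply: measurableU; apply: (m1 _).1.
have N0 : leb N = 0.
  by rewrite -(m1 s).2; apply: measureU0;
    [exact: (m1 _).1|exact: (m1 _).1|exact: (m1 _).2].
apply: (@le_trans _ _ ((b - a)^-1%:E * \int[leb]_(x in `[s, t]) h x)).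
  rewrite mulrC EFinM lee_pmul2l ?fin_numE ?lte_fin//.
  by apply: le_trans (phi_dist s0 st tl); rewrite lee_fin.
rewrite (ge0_negligible_integral mN mst mhst _ N0)//.
rewrite -ge0_integralZl//; last 3 first.
- exact: measurableD.
- by apply: measurable_funS mhst => //; exact: subDsetl.
- by rewrite lee_fin ltW.
apply: (@le_trans _ _ (\int[leb]_(x in `[s, t] `\` N) trunc_gradient a b f h
  x)).
  apply: ge0_le_integral_nonmeasurable => x.
    by rewrite mule_ge0// lee_fin ltW.
  rewrite /= in_itv/= => -[/andP[sx xt] Nx].
  rewrite trunc_gradientE.
    by rewrite (phiab x _)//; rewrite !lt_neqAle sx xt !andbT; apply/andP;
      split;
      apply/eqP => E; apply: Nx; [left|right].
  by rewrite /= in_itv/= (le_trans s0 sx) (le_trans xt tl).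
by apply: ge0_subset_integral_nonmeasurable => // x [/(subitv s0 tl)].
Qed.

End truncation_line.

(** * Truncation of Newtonian functions *)

Section borel.
Context {R : realType} {X : pmetricType R}.
Variable mu : {measure set (borelType X) -> \bar R}.
Local Open Scope ereal_scope.

Lemma open_borel (U : set X) : open U -> measurable (U : set (borelType X)).
Proof. by move=> oU; exact: sub_sigma_algebra. Qed.

Lemma borel_mu_measurable (A : set X) :
  measurable (A : set (borelType X)) -> mu_measurable mu A.
Proof. exact: caratheodory_measurable_mu_ext. Qed.

Lemma open_mu_measurable (U : set X) : open U -> mu_measurable mu U.
Proof. by move=> oU; apply: borel_mu_measurable; exact: open_borel. Qed.

Lemma borel_mu_measurable_fun (g : X -> \bar R) : borel_fun g ->
  mu_measurable_fun mu g.
Proof.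
move=> mg _ B mB; rewrite setTI; apply: borel_mu_measurable.
by rewrite -[X in measurable X]setTI; exact: mg.
Qed.

Lemma metric_openP (U : set X) : (forall x, U x -> exists2 e : R, (0 < e)%R &
    forall y, (mdist x y < e)%R -> U y) -> open U.
Proof.
move=> UP; rewrite openE => x /UP[e e0 eU].
by apply/nbhs_ballP; exists e => // y; rewrite ballEmdist => /eU.
Qed.

Lemma metric_ball_open (x : X) (r : R) : open (ball x r).
Proof.
apply: metric_openP => y; rewrite ballEmdist /= => xy.
exists (r - mdist x y)%R; first by rewrite subr_gt0.
by move=> z; rewrite ltrBrDl; apply: le_lt_trans; exact: metric_triangle.
Qed.

Hypothesis mu_balls : positive_finite_on_balls mu.

Lemma sigma_finite_of_balls : @sigma_finite _ (borelType X) _ setT mu.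
Proof.
exists (fun n => ball (point : X) n.+1%:R).
  apply/esym; rewrite -subTset => x _;
    exists (Num.truncn (mdist (point : X) x)) => //.
  by rewrite ballEmdist/=; exact: truncnS_gt.
move=> n; split; first exact: (open_borel (metric_ball_open _ _)).
by have [] := mu_balls point (r := n.+1%:R) (ltr0Sn _ _).
Qed.

End borel.

Section truncation_newtonian.
Context {R : realType} {X : pmetricType R}.
Variable mu : {measure set (borelType X) -> \bar R}.
Hypothesis mu_balls : positive_finite_on_balls mu.
Local Open Scope ereal_scope.
Notation muc := (completion mu).
Variables (p a b : R).
Hypotheses (p1 : (1 <= p)%R) (a0 : (0 <= a)%R) (ab : (a < b)%R).
Let p0 : (0 < p)%R. Proof. exact: lt_le_trans p1. Qed.
Let ba0 : (0 < (b - a)^-1)%R. Proof. by rewrite invr_gt0 subr_gt0. Qed.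
Implicit Types (u g : X -> \bar R).

Lemma measurable_abse_poweR (f : X -> \bar R) (r : R) :
  mu_measurable_fun mu f -> mu_measurable_fun mu (fun x => `|f x| `^ r).
Proof.
move=> mf.
exact: (measurableT_comp (measurable_poweR r) (measurableT_comp _ mf)).
Qed.

(** An exceptional density has to be Borel, whereas [g] is only [mu]-measurable; the majorant [g']
    can be built into such a density. *)
Lemma borel_majorant_Lp g : Lp mu p g -> (forall x, 0 <= g x) ->
  exists g', [/\ borel_fun g', forall x, g x <= g' x & Lp mu p g'].
Proof.
move=> [mg gp] g0.
have [g' [mg' gg' [N [mN N0 NP]]]] :=
  measurable_fun_majorant (sigma_finite_of_balls mu_balls) mg g0.
exists g'; split => //; split; first exact: borel_mu_measurable_fun.
suff <- : \int[muc]_x `|g x| `^ p = \int[muc]_x `|g' x| `^ p by [].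
have ae : ae_eq muc setT (fun x => `|g x| `^ p) (fun x => `|g' x| `^ p).
  by exists N; split => // x /= H; apply: contrapT => /NP E; apply: H;
    rewrite E.
exact: (@ge0_ae_eq_integral _ _ _ muc _ _ _ measurableT
  (measurable_abse_poweR p mg)
  (measurable_abse_poweR p (borel_mu_measurable_fun mg')) (fun x _ =>
    poweR_ge0 _ _)
  (fun x _ => poweR_ge0 _ _) ae).
Qed.

Lemma measurable_trunc u : mu_measurable_fun mu u ->
  mu_measurable_fun mu (trunc a b u).
Proof.
move=> mu_.
have mt : measurable_fun setT (fun y : \bar R =>
  ((clip a b y - a) / (b - a))%:E).
  apply/measurable_EFinP; apply: measurable_funM; last exact: measurable_cst.
  apply: measurable_funB; last exact: measurable_cst.
  apply: measurableT_comp; first exact: fine_measurable.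
  apply: measurable_maxe; first exact: measurable_cst.
  by apply: measurable_mine; [exact: measurable_cst|exact: abse_measurable].
exact: (measurableT_comp mt mu_).
Qed.

Lemma measurable_trunc_gradient u g : mu_measurable_fun mu u ->
  mu_measurable_fun mu g ->
  mu_measurable_fun mu (trunc_gradient a b u g).
Proof.
move=> mu_ mg.
have mt : measurable_fun setT (fun y : \bar R =>
  (a%:E < `|y|) && (`|y| < b%:E)).
  apply: measurable_and; apply: measurable_fun_lte;
    by [exact: measurable_cst|exact: abse_measurable].
apply: (measurable_fun_ifT (measurableT_comp mt mu_)).
- exact: (measurable_funeM _ mg).
- exact: measurable_cst.
Qed.

Lemma trunc_gradient_ge0 u g : (forall x, 0 <= g x) ->
  forall x, 0 <= trunc_gradient a b u g x.
Proof.
by move=> g0 x; rewrite /trunc_gradient; case: ifP => // _;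
  rewrite mule_ge0// lee_fin ltW.
Qed.

Lemma weak_upper_gradient_trunc u g : mu_measurable_fun mu u ->
  Dp mu p u g ->
  weak_upper_gradient mu p (trunc a b u) (trunc_gradient a b u g).
Proof.
move=> mu_ [[mg g0 [rho [brho rho0 [mrho locrho] rhoP]]] Lpg].
have [g' [bg' gg' [mg' g'p]]] := borel_majorant_Lp Lpg g0.
have g'0 x : 0 <= g' x by exact: le_trans (gg' x).
split; first exact: measurable_trunc_gradient.
  exact: trunc_gradient_ge0.
(* If this maximum has finite integral along a curve, then so do [rho], which gives the inequality
   on all subcurves, and [g], which gives the continuity needed for the truncation. *)
exists (fun x => maxe (rho x) (g' x)); split.
- exact: (measurable_maxe brho bg').
- by move=> x; rewrite le_max rho0.
- split; first exact: (measurable_maxe mrho mg').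
  move=> x; have [r r0 rhor] := locrho x; exists r => //.
  have mb := open_mu_measurable mu (metric_ball_open x r).
  apply: (@le_lt_trans _ _ (\int[muc]_(y in ball x r) (`|rho y| `^ p + `|g' y|
    `^ p))).
    apply: ge0_le_integral_nonmeasurable => y _; first exact: poweR_ge0.
    by case: (leP (rho y) (g' y)) => _; rewrite ?leeDl ?leeDr ?poweR_ge0.
  rewrite (ge0_integralD muc mb (fun y _ =>
    poweR_ge0 _ _) (measurable_funTS (measurable_abse_poweR p mrho))
    (fun y _ => poweR_ge0 _ _) (measurable_funTS (measurable_abse_poweR p
      mg'))).
  rewrite lte_add_pinfty//; apply: le_lt_trans g'p.
  by apply: ge0_subset_integral_nonmeasurable => // y _; exact: poweR_ge0.
- move=> gam l arcgam Nineq; apply: contrapT => /eqP; rewrite -ltey => fin.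
  have finle (f : X -> \bar R) : (forall x, 0 <= f x) ->
      (forall x, f x <= maxe (rho x) (g' x)) -> curve_integral f gam l < +oo.
    move=> f0 fm; apply: le_lt_trans fin.
    by apply: ge0_le_integral_nonmeasurable => t _.
  have rhofin : curve_integral rho gam l < +oo.
    by apply: finle => // x; rewrite le_max lexx.
  have gfin : curve_integral g gam l < +oo.
    by apply: finle => // x; rewrite le_max gg' orbT.
  have [_ mgl _] : upper_gradient_ineq u g gam l.
    by apply: contrapT => /(rhoP _ _ arcgam); apply/eqP; rewrite lt_eqF.
  have l0 : (0 < l)%R by case: arcgam.
  have sub := upper_gradient_ineq_subcurve rho0 g0 arcgam rhoP rhofin.
  have g0' t : 0 <= (g \o gam) t by exact: g0.
  apply: Nineq; split => //.
  + exact: (@measurable_trunc_gradient_line _ l (u \o gam) (g \o gam) l0 g0'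
      mgl gfin sub).
  + exact: (@trunc_le_integral_trunc_gradient _ l (u \o gam) (g \o gam) l0 g0'
      mgl gfin sub).
Qed.

Lemma Lp_dominated (k : R) u v : (0 <= k)%R -> Lp mu p u ->
  mu_measurable_fun mu v ->
  (forall x, `|v x| <= k%:E * `|u x|) -> Lp mu p v.
Proof.
move=> k0 [mu_ up] mv vu; split => //.
apply: (@le_lt_trans _ _ (\int[muc]_x ((k%:E `^ p) * `|u x| `^ p))).
  apply: ge0_le_integral_nonmeasurable => x _; first exact: poweR_ge0.
  by rewrite -poweRM ?lee_fin//; apply: le_poweR => //; exact: ltW.
rewrite (ge0_integralZl muc measurableT (measurable_abse_poweR p mu_)
  (fun x _ => poweR_ge0 _ _) (poweR_ge0 _ _)).
by apply: lte_mul_pinfty => //; rewrite ?poweR_ge0// poweR_EFin.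
Qed.

Lemma clip_bounds y : (a <= clip a b y)%R /\ (clip a b y <= b)%R.
Proof.
have ab' := ltW ab; rewrite /clip; case: y => [y| |] /=; last 2 first.
- by rewrite miney max_r ?lee_fin//=; split.
- by rewrite miney max_r ?lee_fin//=; split.
by rewrite -EFin_min -EFin_max/= le_max lexx ge_max ab' ge_min lexx.
Qed.

Lemma clip_le y : (clip a b y - a)%:E <= `|y|.
Proof.
have [ac cb] := clip_bounds y; case: y ac cb => [y| |] ac cb; rewrite ?leey//.
rewrite clip_fin//= lee_fin; move: a0 (normr_ge0 y) => a0' y0.
rewrite /Num.max/Num.min/=; case: (ltP b `|y|)%R => ?; case: ltP => ?; lra.
Qed.

Lemma trunc_ge0 u x : 0 <= trunc a b u x.
Proof.
by rewrite lee_fin divr_ge0 ?subr_ge0// ?(clip_bounds _).1// ltW.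
Qed.

Lemma trunc_eq1 u x : b%:E <= `|u x| -> trunc a b u x = 1.
Proof.
rewrite /trunc /clip => bu; rewrite min_l// max_r ?lee_fin ?ltW//= divff//.
by rewrite subr_eq0 gt_eqF.
Qed.

Lemma trunc_eq0 u x : u x = 0 -> trunc a b u x = 0.
Proof.
move=> ux; rewrite /trunc ux /clip abse0 min_r ?lee_fin ?(le_trans a0 (ltW
  ab))//.
by rewrite max_l ?lee_fin//= subrr mul0r.
Qed.

Lemma Lp_trunc u : Lp mu p u -> Lp mu p (trunc a b u).
Proof.
move=> Lu; apply: (Lp_dominated (ltW ba0) Lu);
  first exact: measurable_trunc (proj1 Lu).
move=> x; rewrite gee0_abs ?trunc_ge0// /trunc mulrC EFinM.
by apply: lee_wpmul2l; [rewrite lee_fin ltW|exact: clip_le].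
Qed.

Lemma Dp_trunc u g : Lp mu p u -> Dp mu p u g ->
  Dp mu p (trunc a b u) (trunc_gradient a b u g).
Proof.
move=> [mu_ _] Dg; split; first exact: weak_upper_gradient_trunc.
move: Dg => [[mg g0 _] Lg]; apply: (Lp_dominated (ltW ba0) Lg).
  exact: measurable_trunc_gradient.
move=> x; rewrite (gee0_abs (g0 x)) gee0_abs; last exact: trunc_gradient_ge0.
rewrite /trunc_gradient; case: ifP => // _.
by rewrite mule_ge0// lee_fin ltW.
Qed.

Lemma well_insideS (A B Omega : set X) : A `<=` B -> well_inside B Omega ->
  well_inside A Omega.
Proof.
move=> AB [[x [r Br]] dB]; split; first by exists x, r; exact: subset_trans Br.
apply: lt_le_trans dB _; apply: ereal_inf_le_tmp => _ [y Ay [z Oz <-]].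
by exists y; [exact: AB|exists z].
Qed.

Lemma N1p_c_trunc (Omega : set X) u g : N1p_c mu p Omega u -> Dp mu p u g ->
  N1p_c mu p Omega (trunc a b u).
Proof.
move=> [[Lu _] su] Dg; split; last first.
  apply: well_insideS su; apply: closure_subset => x /=.
  by apply: contra_neq => /trunc_eq0.
have [_ Ltu] := Lp_trunc Lu; have Dtg := Dp_trunc Lu Dg.
split; first exact: Lp_trunc.
apply: poweR_lty; apply: lte_add_pinfty => //.
apply: (@le_lt_trans _ _ (\int[muc]_x trunc_gradient a b u g x `^ p)).
  by apply: ereal_inf_lbound; exists (trunc_gradient a b u g).
move: Dtg => [[_ tg0 _] [_ Ltg]]; apply: le_lt_trans Ltg.
apply: ge0_le_integral_nonmeasurable => x _; first exact: poweR_ge0.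
by rewrite gee0_abs.
Qed.

Lemma cap_le_trunc_energy (beta : R) (Omega : set X) u g :
  N1p_c mu p Omega u -> Dp mu p u g ->
  cap mu p beta [set x | b%:E <= `|u x|] Omega <=
    weighted_energy mu p beta Omega (trunc_gradient a b u g).
Proof.
move=> Nu Dg; have [[Lu _] _] := Nu.
apply: (@le_trans _ _ (ereal_inf [set weighted_energy mu p beta Omega g | g in
  Dp mu p (trunc a b u)])).
  apply: ereal_inf_lbound; exists (trunc a b u) => //; split.
    exact: N1p_c_trunc Dg.
  by move=> x /trunc_eq1 ->.
by apply: ereal_inf_lbound; exists (trunc_gradient a b u g) => //;
  exact: Dp_trunc.
Qed.

End truncation_newtonian.

(** * Layers *)

Section weight.
Context {R : realType} {X : pmetricType R}.
Variable mu : {measure set (borelType X) -> \bar R}.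
Local Open Scope ereal_scope.

Lemma lower_semicontinuous_borel (f : X -> \bar R) :
  (forall c, open [set x | c%:E < f x]) -> borel_fun f.
Proof.
move=> of_; apply: (measurability _ (ErealGenOInfty.measurableE R)).
move=> /= _ [_ [c ->]] <-; rewrite setTI; apply: open_borel.
by rewrite preimage_itvoy.
Qed.

Variable Omega : set X.
Hypothesis properOmega : Omega `<` [set: X].
Let dist x := dist_to x (~` Omega).

Lemma dist_to_lipschitz x y : (dist x <= mdist x y + dist y)%R.
Proof.
have [z0 Oz0] : ~` Omega !=set0.
  have [_ OT] := properOmega; apply: contrapT => O0; apply: OT => z _.
  by apply: contrapT => Oz; apply: O0; exists z.
rewrite -lerBlDl; apply: lb_le_inf; first by exists (mdist y z0), z0.
move=> _ [z Oz <-]; rewrite lerBlDl.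
apply: le_trans (metric_triangle x y z); apply: ge_inf; last by exists z.
by exists 0%R => _ [w _ <-]; exact: mdist_ge0.
Qed.

Lemma borel_dist : borel_fun (fun x => (dist x)%:E).
Proof.
apply: lower_semicontinuous_borel => c; apply: metric_openP => x /=;
  rewrite lte_fin => cx.
exists (dist x - c)%R; first by rewrite /= subr_gt0.
move=> y; rewrite lte_fin; have := dist_to_lipschitz x y; lra.
Qed.

(** The function is lower semicontinuous: slightly smaller concentric balls exhaust the ball at [x],
    and each of them is contained in the balls attached to all nearby points. *)
Lemma borel_ball_measure : borel_fun (fun x => mu (ball x (dist x))).
Proof.
apply: lower_semicontinuous_borel => c; apply: metric_openP => x /= cx.
pose F n := ball x (dist x - n.+1%:R^-1)%R.
have FE : \bigcup_n F n = ball x (dist x).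
  apply/seteqP; split => [y [n _]|y].
    rewrite /F !ballEmdist/= => /lt_trans; apply.
    by rewrite ltrBlDr ltrDl invr_gt0.
  rewrite ballEmdist/= => xy.
  have d0 : (0 < dist x - mdist x y)%R by rewrite subr_gt0.
  have [n _ /(_ n (leqnn n))/= nd] := near_infty_natSinv_lt (PosNum d0).
  by exists n => //; rewrite /F ballEmdist/= ltrBrDr -ltrBrDl.
have mF n : measurable (F n : set (borelType X)) by exact: (open_borel
  (metric_ball_open _ _)).
have Fcvg : mu (F n) @[n --> \oo] --> mu (ball x (dist x)).
  rewrite -FE; apply: (@nondecreasing_cvg_mu _ (borelType X) _ mu F mF).
    by rewrite FE; exact: (open_borel (metric_ball_open _ _)).
  move=> n m nm; apply/subsetPset => y;
    rewrite /F !ballEmdist/= => /lt_le_trans; apply.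
  by rewrite lerD2l lerN2 lef_pV2 ?posrE// ler_nat.
have [n cn] : exists n, c%:E < mu (F n).
  apply: contrapT => nc; move: cx; apply/negP; rewrite -leNgt.
  rewrite -(cvg_lim (@ereal_hausdorff _) Fcvg); apply: lime_le;
    first by apply/cvg_ex; eexists; exact: Fcvg.
  by apply: nearW => n; rewrite leNgt; apply/negP => cn; apply: nc; exists n.
(* [F n] has radius smaller by 1 / (n + 1). Half of this gap absorbs the move of the centre and the
   other half the loss in [dist]. *)
exists (n.+1%:R^-1 / 2)%R; first by rewrite divr_gt0.
move=> y xy; apply: lt_le_trans cn _.
apply: le_measure; rewrite ?inE//; first exact: (open_borel (metric_ball_open _
  _)).
move=> z; rewrite /F !ballEmdist/= => xz.
have := metric_triangle y x z; have := dist_to_lipschitz x y.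
rewrite (metric_sym y x).
by move: xy xz; move: (n.+1%:R^-1)%R => e; lra.
Qed.

Lemma borel_hardy_sobolev_weight (q p beta : R) :
  borel_fun (hardy_sobolev_weight mu q p beta Omega).
Proof.
apply: emeasurable_funM.
  exact: (measurableT_comp (measurable_poweR _) borel_ball_measure).
have mt : measurable_fun setT (fun y : \bar R => y `^ (- (q / p * (p - beta)))).
  exact: measurable_poweR.
have := measurableT_comp mt borel_dist.
by apply: eq_measurable_fun => x _; rewrite /comp poweR_EFin powRN.
Qed.

Lemma hardy_sobolev_weight_ge0 (q p beta : R) x :
  0 <= hardy_sobolev_weight mu q p beta Omega x.
Proof. by rewrite mule_ge0 ?poweR_ge0// lee_fin invr_ge0 powR_ge0. Qed.

Lemma borel_dist_power (beta : R) :
  borel_fun (fun x => (dist x `^ beta)%:E).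
Proof.
have := measurableT_comp (measurable_poweR beta) borel_dist.
by apply: eq_measurable_fun => x _; rewrite /comp poweR_EFin.
Qed.

End weight.

Section layers.
Context {R : realType} {X : pmetricType R}.
Implicit Types (u : X -> \bar R) (k : int).

Definition pow2 k : R := 2 `^ (k%:~R).

Lemma pow2_gt0 k : 0 < pow2 k. Proof. by apply: powR_gt0; rewrite ltr0n. Qed.

Lemma pow2S k : pow2 (k + 1) = 2 * pow2 k.
Proof.
have n20 : 2 != 0 :> R by rewrite pnatr_eq0.
rewrite /pow2 intrD powRD; last by rewrite n20 implybT.
by rewrite powRr1 ?ler0n// mulrC.
Qed.

Lemma pow2_le k k' : k <= k' -> pow2 k <= pow2 k'.
Proof. by move=> kk'; rewrite ler_powR ?ler_int// ler1n. Qed.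

(** Half-open, so that the layers partition the set where 0 < |u| < +oo; the open layer seen by
    [trunc_gradient] lies inside. *)
Definition layer u k : set X :=
  [set x | ((pow2 k)%:E <= `|u x|)%E /\ (`|u x| < (pow2 (k + 1))%:E)%E].

Lemma layer_disjoint u k k' : k != k' -> layer u k `&` layer u k' = set0.
Proof.
move=> kk'; rewrite -subset0 => x [[k1 k2] [k'1 k'2]].
have H j j' : j < j' -> (`|u x| < (pow2 (j + 1))%:E)%E ->
  ((pow2 j')%:E <= `|u x|)%E -> False.
  move=> jj' h1 h2; have := le_lt_trans h2 h1; rewrite lte_fin ltNge => /negP;
    apply.
  by apply: pow2_le; rewrite lezD1.
by move: kk'; rewrite neq_lt => /orP[] h;
  [exact: (H _ _ h k2 k'1)|exact: (H _ _ h k'2 k1)].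
Qed.

Lemma layer_cover u x : (0 < `|u x|)%E -> (`|u x| < +oo)%E ->
  exists k, layer u k x.
Proof.
rewrite /layer /=; case: (`|u x|)%E => // y; rewrite lte_fin => y0 _.
have ln2 : 0 < ln 2 :> R by rewrite ln_gt0// ltr1n.
(* The base 2 logarithm of [y]; its integer part is the index of the layer. *)
pose t := ln y / ln 2.
have ty : y = 2 `^ t by rewrite /powR pnatr_eq0/= /t divfK ?gt_eqF// lnK.
have /andP[kt tk] := floor_itv t.
exists (Num.floor t); rewrite lee_fin lte_fin ty; split.
  by rewrite ler_powR// ler1n.
by rewrite /pow2 /powR pnatr_eq0/= ltr_expR ltr_pM2r.
Qed.

End layers.

(** * Summation of the capacity estimates over the layers *)

Section mazya.
Context {R : realType} {X : pmetricType R}.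
Variable mu : {measure set (borelType X) -> \bar R}.
Hypothesis mu_balls : positive_finite_on_balls mu.
Variables (p q beta : R).
Hypotheses (p1 : 1 <= p) (pq : p <= q).
Variable Omega : set X.
Hypotheses (openOmega : open Omega) (properOmega : Omega `<` [set: X]).
Local Open Scope ereal_scope.
Notation muc := (completion mu).
Notation w := (hardy_sobolev_weight mu q p beta Omega).
Notation dbeta := (fun x => (dist_to x (~` Omega) `^ beta)%:E).
Let p0 : (0 < p)%R. Proof. exact: lt_le_trans p1. Qed.
Let q0 : (0 < q)%R. Proof. exact: lt_le_trans pq. Qed.
Let r1 : (1 <= q / p)%R. Proof. by rewrite ler_pdivlMr ?mul1r. Qed.
Let r0 : (0 < q / p)%R. Proof. exact: lt_le_trans r1. Qed.

Let mw : mu_measurable_fun mu w.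
Proof. by apply: borel_mu_measurable_fun;
  exact: borel_hardy_sobolev_weight. Qed.

Let w0 x : 0 <= w x. Proof. exact: hardy_sobolev_weight_ge0. Qed.

Let mOmega : mu_measurable mu Omega. Proof. exact: open_mu_measurable. Qed.

Let mdbeta : mu_measurable_fun mu dbeta.
Proof. by apply: borel_mu_measurable_fun; exact: borel_dist_power. Qed.

Let dbeta0 x : 0 <= dbeta x. Proof. by rewrite lee_fin powR_ge0. Qed.

Section estimate.
Variable C : R.
Hypothesis C0 : (0 <= C)%R.
Hypothesis capC : forall E : set X, mu_measurable mu E -> well_inside E Omega ->
  \int[muc]_(x in E) w x <= C%:E * cap mu p beta E Omega `^ (q / p).
Variables u g : X -> \bar R.
Hypotheses (Nu : N1p_c mu p Omega u) (Dg : Dp mu p u g).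

Let mu_ : mu_measurable_fun mu u. Proof. by case: Nu => [[[]]]. Qed.
Let mg : mu_measurable_fun mu g. Proof. by case: Dg => [[]]. Qed.
Let g0 x : 0 <= g x. Proof. by case: Dg => [[]]. Qed.
Let F x := g x `^ p * dbeta x.
Let F0 x : 0 <= F x. Proof. by rewrite mule_ge0 ?poweR_ge0. Qed.
Let mF : mu_measurable_fun mu F.
Proof. exact: (emeasurable_funM (measurableT_comp (measurable_poweR p) mg)
  mdbeta). Qed.

Let mabsu : mu_measurable_fun mu (fun x => `|u x|).
Proof. exact: (measurableT_comp (@abse_measurable _ _) mu_). Qed.

Let mlayer k : mu_measurable mu (layer u k).
Proof.
have m1 := emeasurable_fun_c_infty measurableT mabsu (pow2 k)%:E.
have m2 := emeasurable_fun_infty_o measurableT mabsu (pow2 (k + 1))%:E.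
by rewrite !setTI in m1 m2; exact: (measurableI _ _ m1 m2).
Qed.

(** The gap between the heights [pow2 k] and [pow2 (k + 1)] is [pow2 k] itself, whence the factor in
    front. *)
Let energy_trunc k :
  weighted_energy mu p beta Omega
    (trunc_gradient (pow2 k) (pow2 (k + 1)) u g) <=
    ((pow2 k)^-1 `^ p)%:E * \int[muc]_(x in Omega `&` layer u k) F x.
Proof.
have ck0 := @pow2_gt0 R k.
have cE : (pow2 (k + 1) - pow2 k = pow2 k :> R)%R by rewrite pow2S mulr_natl
  mulr2n addrK.
rewrite integral_mkcondr.
have mFl : measurable_fun (Omega : set (caratheodory_type (mu^*)%mu))
    (F \_ (layer u k)).
  apply: measurable_funTS.
  exact: (proj1 (measurable_restrictT _ (mlayer k)) (measurable_funTS mF)).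
have Fl0 x : 0 <= (F \_ (layer u k)) x by apply: erestrict_ge0.
rewrite -(ge0_integralZl muc mOmega mFl (fun x _ =>
  Fl0 x)) ?lee_fin ?powR_ge0//.
apply: ge0_le_integral_nonmeasurable => x _;
  first by rewrite mule_ge0 ?poweR_ge0.
rewrite /trunc_gradient cE; case: ifP => [/andP[h1 h2]|_]; last first.
  by rewrite poweR0r ?gt_eqF// mul0e mule_ge0// lee_fin powR_ge0.
rewrite patchE mem_set; last by split => //; exact: ltW.
have ick0 : 0 <= (((pow2 k)^-1)%R : R)%:E by rewrite lee_fin invr_ge0 ltW.
by rewrite (poweRM _ ick0 (g0 x)) poweR_EFin -muleA.
Qed.

(** On layer [k + 1], |u| is below [pow2 (k + 2)]. The capacity inequality for the whole superlevel
    set [E] at height [pow2 (k + 1)], tested with the truncation between [pow2 k] and that height,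
    contributes [pow2 k] to the power -q. The quotient of the two heights is 4, which gives 4^q. *)
Let layer_estimate k :
  \int[muc]_(x in Omega `&` layer u (k + 1)) (`|u x| `^ q * w x) <=
  (C * 4 `^ q)%:E * (\int[muc]_(x in Omega `&` layer u k) F x) `^ (q / p).
Proof.
have ck0 := @pow2_gt0 R k.
set e := \int[muc]_(x in Omega `&` layer u k) F x.
have e0 : 0 <= e by exact: integral_ge0.
pose E := [set x | (pow2 (k + 1))%:E <= `|u x|].
have mE : mu_measurable mu E.
  by have := emeasurable_fun_c_infty measurableT mabsu (pow2 (k + 1))%:E;
    rewrite setTI.
have EOmega : well_inside E Omega.
  have [_] := Nu; apply: well_insideS => x Ex; apply: subset_closure => /=.
  by apply: contraTneq Ex => ->; rewrite abse0 -ltNge lte_fin pow2_gt0.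
have b0 : (0 <= pow2 (k + 1 + 1) `^ q)%R by exact: powR_ge0.
apply: (@le_trans _ _ ((pow2 (k + 1 + 1) `^ q)%:E * \int[muc]_(x in E) w x)).
  rewrite -(ge0_integralZl muc mE (measurable_funTS mw) (fun x _ =>
    w0 x)) ?lee_fin//.
  apply: (@le_trans _ _ (\int[muc]_(x in Omega `&` layer u (k + 1))
      ((pow2 (k + 1 + 1) `^ q)%:E * w x))).
    apply: ge0_le_integral_nonmeasurable => x;
      first by rewrite mule_ge0 ?poweR_ge0.
    move=> [_ [_ uk]]; apply: lee_wpmul2r => //; rewrite -poweR_EFin.
    by apply: le_poweR; [exact: ltW| |exact: ltW].
  apply: ge0_subset_integral_nonmeasurable; last by move=> x [_ []].
  by move=> x _; rewrite mule_ge0.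
have cape : cap mu p beta E Omega <= ((pow2 k)^-1 `^ p)%:E * e.
  apply: le_trans (energy_trunc k).
  apply: cap_le_trunc_energy => //; first exact: ltW.
  by rewrite pow2S ltr_pMl// ltr1n.
have cap0 : 0 <= cap mu p beta E Omega.
  apply: le_ereal_inf_tmp => _ [v _ <-]; apply: le_ereal_inf_tmp => _ [h Dh <-].
  by apply: integral_ge0 => x _; rewrite mule_ge0 ?poweR_ge0.
apply: (@le_trans _ _ ((pow2 (k + 1 + 1) `^ q)%:E *
    (C%:E * (((pow2 k)^-1 `^ p)%:E * e) `^ (q / p)))).
  apply: lee_wpmul2l; first by rewrite lee_fin.
  apply: le_trans (capC mE EOmega) _; apply: lee_wpmul2l;
    first by rewrite lee_fin.
  by apply: le_poweR => //; exact: ltW.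
rewrite poweRM ?lee_fin ?powR_ge0//
  poweR_EFin -powRrM mulrCA divff ?gt_eqF// mulr1.
rewrite !muleA -!EFinM; apply: lee_wpmul2r; first exact: poweR_ge0.
rewrite lee_fin mulrAC mulrC ler_wpM2l// -powRM ?invr_ge0 ?(ltW (pow2_gt0 _))//.
rewrite !pow2S mulrA mulfK ?gt_eqF//.
by have -> : (2 * 2 = 4 :> R)%R by lra.
Qed.

(* The layers are reindexed by [nat], as required for countable additivity. *)
Let nat_layer (d : int) (n : nat) : set X :=
  if pickle_inv n is Some k then Omega `&` layer u (k + d) else set0.

Let mnat_layer d n : mu_measurable mu (nat_layer d n).
Proof.
rewrite /nat_layer; case: pickle_inv => [k|].
  exact: (measurableI _ _ mOmega (mlayer _)).
exact: (@measurable0 _ (caratheodory_type (mu^*)%mu)).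
Qed.

Let trivIset_nat_layer d : trivIset setT (nat_layer d).
Proof.
apply/trivIsetP => n m _ _ nm; rewrite /nat_layer.
case En : (pickle_inv n) => [k|]; last by rewrite set0I.
case Em : (pickle_inv m) => [k'|]; last by rewrite setI0.
rewrite setIACA layer_disjoint ?setI0//; apply: contra_neq nm => /addIr kk'.
by have := @pickle_invK int n; have := @pickle_invK int m;
  rewrite En Em/= kk' => <- <-.
Qed.

(** Layer [k + 1] on the left is controlled by layer [k] on the right, so the enumeration with shift
    1 is compared term by term with the one with shift 0. The latter layers are disjoint, so their
    energies add up to at most the energy of [g]. *)
Lemma hardy_sobolev_estimate :
  \int[muc]_(x in Omega) (`|u x| `^ q * w x) <=
    (C * 4 `^ q)%:E * weighted_energy mu p beta Omega g `^ (q / p).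
Proof.
pose G x := `|u x| `^ q * w x.
have G0 x : 0 <= G x by rewrite mule_ge0 ?poweR_ge0.
have mG : mu_measurable_fun mu G.
  exact: (emeasurable_funM (measurable_abse_poweR q mu_) mw).
have C40 : 0 <= (C * 4 `^ q)%:E by rewrite lee_fin mulr_ge0 ?powR_ge0.
pose U d := \bigcup_n nat_layer d n.
have mU d : mu_measurable mu (U d).
  exact: (@bigcupT_measurable _ (caratheodory_type (mu^*)%mu) _ (mnat_layer d)).
pose e n : \bar R := \int[muc]_(x in nat_layer 0%R n) F x.
have e0 n : 0 <= e n by apply: integral_ge0.
have sume N : \sum_(0 <= n < N) e n <= weighted_energy mu p beta Omega g.
  have H1 : \sum_(0 <= n < N) e n <= \int[muc]_(x in U 0%R) F x.
    rewrite (ge0_integral_bigcup muc (mnat_layer 0%R) (measurable_funTS mF)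
      (fun x _ => F0 x) (@trivIset_nat_layer 0%R)).
    by apply: nneseries_lim_ge => n _ _; exact: e0.
  apply: le_trans H1 _.
  apply: ge0_subset_integral_nonmeasurable => [x _|x [n _]]; first exact: F0.
  by rewrite /nat_layer; case: pickle_inv => // k [].
have layerle n : \int[muc]_(x in nat_layer 1%R n) G x <=
    (C * 4 `^ q)%:E * e n `^ (q / p).
  rewrite /e /nat_layer; case: pickle_inv => [k|].
    by rewrite addr0; exact: layer_estimate.
  by rewrite integral_set0 mule_ge0 ?poweR_ge0.
have [[[_ up] _] _] := Nu.
have up_integrable : muc.-integrable setT (fun x => `|u x| `^ p).
  apply/integrableP; split; first exact: measurable_abse_poweR.
  apply: le_lt_trans up; apply: ge0_le_integral_nonmeasurable => x _ //.
  by rewrite gee0_abs// poweR_ge0.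
(* The layers miss the points where [u] is 0 or infinite. The latter form a null set since [u] is in
   L^p, and at the former the integrand vanishes because [q > 0]. *)
have [N [mN N0 NP]] := integrable_ae measurableT up_integrable.
rewrite (ge0_negligible_integral mN mOmega (measurable_funTS mG) (fun x _ =>
  G0 x) N0).
apply: (@le_trans _ _ (\int[muc]_(x in U 1%R) G x)).
  rewrite integral_mkcond [leRHS]integral_mkcond.
  apply: ge0_le_integral_nonmeasurable => x _; first exact: erestrict_ge0.
  rewrite [leLHS]patchE; case: ifPn => [/set_mem[Ox Nx]|_];
    last exact: erestrict_ge0.
  have [ux0|ux0] := eqVneq (u x) 0.
    apply: (@le_trans _ _ 0); last exact: erestrict_ge0.
    by rewrite /G ux0 abse0 poweR0r ?gt_eqF// mul0e.
  have uxoo : `|u x| < +oo.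
    apply: (@lty_poweRy _ _ p); first by rewrite gt_eqF.
    rewrite ltey_eq; apply/orP; left; apply: contrapT => H; apply: Nx;
      apply: NP => /=.
    by move=> /(_ Logic.I).
  have [k uk] : exists k, layer u k x by apply: layer_cover => //;
    rewrite lt0e abse_eq0 ux0 abse_ge0.
  (* With shift 1, layer [k] is found at the code of [k - 1]. *)
  have Ux : U 1%R x.
    exists (pickle (k - 1)%R); first exact: I.
    by rewrite /nat_layer pickleK_inv subrK; exact: (conj Ox uk).
  by rewrite patchE (mem_set Ux).
rewrite (ge0_integral_bigcup muc (mnat_layer 1%R) (measurable_funTS mG)
  (fun x _ => G0 x) (@trivIset_nat_layer 1%R)).
(* It suffices to bound the partial sums, to which the superadditivity of finite sums applies. *)
apply: lime_le; first by apply: is_cvg_nneseries => n _ _; exact: integral_ge0.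
apply: nearW => M; apply: (@le_trans _ _ (\sum_(0 <= n < M) (C * 4 `^ q)%:E * e
  n `^ (q / p))).
  by apply: lee_sum => n _; exact: layerle.
rewrite -ge0_sume_distrr; last by move=> n _; exact: poweR_ge0.
apply: lee_wpmul2l => //; apply: le_trans (sum_poweR_le _ r1 e0) _.
by apply: le_poweR; [exact: ltW|exact: sume_ge0|exact: sume].
Qed.

End estimate.
End mazya.

(** * Equivalence of the Hardy-Sobolev inequality and the capacity inequality *)

Theorem theorem3p1 (R : realType) (X : pmetricType R)
  (mu : {measure set (borelType X) -> \bar R})
  (mu_balls : positive_finite_on_balls mu) (mu_doubling : doubling mu)
  (p q beta : R) (p_ge1 : 1 <= p) (p_le_q : p <= q)
  (Omega : set X) (openOmega : open Omega) (properOmega : Omega `<` [set: X]) :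
  hardy_sobolev mu q p beta Omega <->
  exists C1 : R, forall E : set X, mu_measurable mu E -> well_inside E Omega ->
    (\int[completion mu]_(x in E)
       hardy_sobolev_weight mu q p beta Omega x
     <= C1%:E * cap mu p beta E Omega `^ (q / p))%E.
Proof.
have p0 : 0 < p by exact: lt_le_trans p_ge1.
have q0 : 0 < q by exact: lt_le_trans p_le_q.
have qp0 : 0 < q / p by exact: divr_gt0.
have pq0 : 0 < p / q by exact: divr_gt0.
have energy0 g : (0 <= weighted_energy mu p beta Omega g)%E.
  by apply: integral_ge0 => x _; rewrite mule_ge0 ?poweR_ge0// lee_fin powR_ge0.
split=> [[C C0 HS]|[C HC]]; last first.
  (* The given constant may be zero or negative, whereas the Hardy-Sobolev constant must be
     positive. *)
  pose C' := Num.max 1 C.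
  have C'0 : 0 < C' by rewrite lt_max ltr01.
  have K0 : 0 < C' * 4 `^ q by rewrite mulr_gt0// powR_gt0.
  (* The summation over layers bounds the q-th power of the left-hand side with constant C' 4^q; the
     q-th root turns the exponent q / p of the energy into 1 / p. *)
  exists ((C' * 4 `^ q) `^ q^-1); first exact: powR_gt0.
  move=> u g Nu Dg.
  have HC' E : mu_measurable mu E -> well_inside E Omega ->
      (\int[completion mu]_(x in E) hardy_sobolev_weight mu q p beta Omega x
       <= C'%:E * cap mu p beta E Omega `^ (q / p))%E.
    move=> mE /(HC _ mE) /le_trans; apply; apply: lee_wpmul2r;
      first exact: poweR_ge0.
    by rewrite lee_fin le_max lexx orbT.
  have := hardy_sobolev_estimate mu_balls p_ge1 p_le_q openOmega properOmega
    (ltW C'0) HC' Nu Dg.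
  have q'0 : 0 <= q^-1 by rewrite invr_ge0 ltW.
  move=> /(le_poweR q'0 _) /le_trans; apply.
    by apply: integral_ge0 => x _; rewrite mule_ge0 ?poweR_ge0//
      hardy_sobolev_weight_ge0.
  rewrite poweRM ?poweR_ge0 ?lee_fin ?(ltW K0)// poweR_EFin -poweRrM.
  by rewrite mulrAC divff ?gt_eqF// mul1r.
exists (C `^ q) => E mE EO.
have EsubO : E `<=` Omega.
  move=> x Ex; apply: contrapT => Ox; have [_] := EO.
  by rewrite ltNge => /negP; apply; apply: ereal_inf_lbound; exists x => //;
    exists x => //; rewrite mdistxx.
set J := (\int[completion mu]_(x in E) hardy_sobolev_weight mu q p beta Omega
  x)%E.
have J0 : (0 <= J)%E by apply: integral_ge0 => x _;
  exact: hardy_sobolev_weight_ge0.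
have Cp0 : 0 < C `^ p by exact: powR_gt0.
(* In this form the left-hand side is free of the test function and bounds the energy of every
   admissible pair from below, so it bounds the infimum. For each pair it is the p-th power of the
   Hardy-Sobolev inequality, with |u|^q >= 1 on [E]. *)
have key : ((C `^ p)^-1%:E * J `^ (p / q) <= cap mu p beta E Omega)%E.
  apply: le_ereal_inf_tmp => _ [u [Nu uE] <-];
    apply: le_ereal_inf_tmp => _ [g Dg <-].
  rewrite lee_pdivrMl//.
  have := HS u g Nu Dg.
  move=> /(le_poweR (ltW p0) (poweR_ge0 _ _)).
  rewrite poweRM ?poweR_ge0 ?lee_fin ?(ltW C0)// -!poweRrM mulVf ?gt_eqF//
    poweRe1//.
  rewrite poweR_EFin mulrC; apply: le_trans; apply: le_poweR => //;
    first exact: ltW.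
  apply: (@le_trans _ _ (\int[completion mu]_(x in E)
    (`|u x| `^ q * hardy_sobolev_weight mu q p beta Omega x))%E).
    apply: ge0_le_integral_nonmeasurable => x Ex;
      first exact: hardy_sobolev_weight_ge0.
    rewrite -[leLHS]mul1e; apply: lee_wpmul2r;
      first exact: hardy_sobolev_weight_ge0.
    rewrite -(poweR1r q); apply: le_poweR => //; first exact: ltW.
    by apply: le_trans (uE _ Ex) (lee_abs _).
  apply: ge0_subset_integral_nonmeasurable => // x _.
  by rewrite mule_ge0 ?poweR_ge0// hardy_sobolev_weight_ge0.
(* Raising to the power q / p recovers [J] itself and turns C^p into the announced constant C^q. *)
rewrite lee_pdivrMl// in key.
have := le_poweR (ltW qp0) (poweR_ge0 _ _) key.
have cap0 : (0 <= cap mu p beta E Omega)%E.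
  by apply: le_ereal_inf_tmp => _ [u _ <-];
    apply: le_ereal_inf_tmp => _ [g _ <-].
rewrite (poweRM _ _ cap0) ?lee_fin ?(ltW Cp0)// poweR_EFin -powRrM -poweRrM.
have -> : p * (q / p) = q by rewrite mulrC divfK ?gt_eqF.
have -> : p / q * (q / p) = 1 by rewrite mulrC mulf_div [q * p]mulrC divff
  ?mulf_neq0 ?gt_eqF.
by rewrite poweRe1.
Qed.
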